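(* An element $(x_n)_{n=1}^\infty\in\ell^\infty$ is a zero divisor of $\ell^\infty$ if and only if there exists $n\geq 1$ such that $x_n=0$.
   Context: $\ell^\infty$ denotes the Banach algebra of all bounded sequences of complex numbers, with coordinatewise operations and the supremum norm. An element $z$ of a ring $R$ is called a zero divisor if either $zx=0$ for some non-zero $x\in R$ or $yz=0$ for some non-zero $y\in R$; in particular, in a non-zero ring the element $0$ counts as a zero divisor. *)

(* Defs.v *)
From HB Require Import structures.
From mathcomp Require Import all_boot all_order all_algebra.
From mathcomp Require Import all_classical all_reals all_analysis.
From mathcomp Require Import complex.

Set Implicit Arguments.
Unset Strict Implicit.
Unset Printing Implicit Defensive.

Import Order.TTheory GRing.Theory Num.Theory.
Import numFieldNormedType.Exports.

Local Open Scope classical_set_scope.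
Local Open Scope ring_scope.

Definition zero_divisor (A : pzRingType) (z : A) : Prop :=
  (exists2 x : A, x != 0 & z * x = 0) \/ (exists2 y : A, y != 0 & y * z = 0).

(* [R[i]^o] is R[i] as a normed space over itself. Its norm is the modulus,
   whose values are the nonnegative reals of R[i]; see [bounded_seqP]. *)
Definition bounded_seq (R : realType) : {pred (nat -> R[i])} :=
  mem [set x : nat -> R[i] | bounded_fun (x : nat -> R[i]^o)].
Arguments bounded_seq R : clear implicits.

Lemma bounded_seqP (R : realType) (x : nat -> R[i]) :
  (x \in bounded_seq R) <-> exists M : R, forall n, `|x n| <= M%:C%C.
Proof.
rewrite inE /=; split.
- move=> [M [Mreal /(_ (M + 1))]].
  rewrite ltrDl ltr01 => /(_ isT) xM; exists (complex.Re (M + 1)) => n.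
  by rewrite RRe_real ?realD ?real1//; exact: xM.
- move=> [M xM]; exists M%:C%C; split; first by apply/complex_realP; exists M.
  by move=> N MN n _; exact: le_trans (xM n) (ltW MN).
Qed.

Lemma bounded_seq_subring (R : realType) : subring_closed (bounded_seq R).
Proof.
split.
- by apply/bounded_seqP; exists 1 => n; rewrite normr1.
- move=> x y /bounded_seqP[M xM] /bounded_seqP[N yN].
  apply/bounded_seqP; exists (M + N) => n; rewrite rmorphD/=.
  by rewrite (le_trans (ler_normB _ _))// lerD.
- move=> x y /bounded_seqP[M xM] /bounded_seqP[N yN].
  apply/bounded_seqP; exists (M * N) => n; rewrite rmorphM/=.
  by rewrite normrM ler_pM.
Qed.

HB.instance Definition _ (R : realType) :=
  GRing.isSubringClosed.Build _ (bounded_seq R) (bounded_seq_subring R).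

(* The ring structure is the one induced by the pointwise operations on
   [nat -> R[i]]. Sequences are indexed from 0: [ell_infty_val x n] is the
   coordinate x_(n+1) of a sequence (x_1, x_2, ...). *)
Record ell_infty (R : realType) := EllInfty {
  ell_infty_val :> nat -> R[i];
  _ : ell_infty_val \in bounded_seq R }.

HB.instance Definition _ (R : realType) :=
  [isSub for @ell_infty_val R].
HB.instance Definition _ (R : realType) :=
  [Choice of ell_infty R by <:].
HB.instance Definition _ (R : realType) :=
  [SubChoice_isSubComNzRing of ell_infty R by <:].

(* Main.v *)
Require Import Defs.
From mathcomp Require Import all_boot all_order all_algebra.
From mathcomp Require Import all_classical all_reals all_analysis.
From mathcomp Require Import complex.

Import GRing.Theory Num.Theory.

Local Open Scope ring_scope.

(** Evaluation at each coordinate is a ring morphism to the integral domain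
    R[i], and these evaluations jointly separate the elements of l^oo. If x
    kills a non-zero y, then y is non-zero at some coordinate n, and
    [x n * y n = 0] forces [x n = 0] ([ell_infty_neq0], [ell_infty_mulE]).
    Conversely, if [x n = 0], then x kills the n-th unit sequence, which is
    bounded and non-zero ([unit_seq]). *)

Lemma ell_infty_mulE (R : realType) (x y : ell_infty R) (n : nat) :
  (x * y) n = x n * y n.
Proof. by []. Qed.

Lemma ell_infty_eq0P (R : realType) (x : ell_infty R) :
  x = 0 <-> forall n, x n = 0.
Proof.
split=> [-> //|x0].
by apply: val_inj; apply/funext => n; exact: x0.
Qed.

Lemma ell_infty_neq0 (R : realType) (x : ell_infty R) :
  x != 0 -> exists n, x n != 0.
Proof.
move=> /eqP xN0; apply: contrapT => /forallNP x0.
by apply: xN0; apply/ell_infty_eq0P => n; apply/eqP/negPn/negP/x0.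
Qed.

Lemma unit_seq_bounded (R : realType) (n : nat) :
  (fun k => (k == n)%:R) \in bounded_seq R.
Proof.
apply/bounded_seqP; exists 1 => k.
by case: (k == n); rewrite ?normr1 ?normr0 ?ler01.
Qed.

Definition unit_seq (R : realType) (n : nat) : ell_infty R :=
  EllInfty (unit_seq_bounded R n).

Lemma unit_seq_neq0 (R : realType) (n : nat) : unit_seq R n != 0.
Proof.
by apply/eqP => /ell_infty_eq0P/(_ n)/eqP; rewrite /= eqxx oner_eq0.
Qed.

Lemma mul_unit_seq (R : realType) (x : ell_infty R) (n : nat) :
  x n = 0 -> x * unit_seq R n = 0.
Proof.
move=> xn0; apply/ell_infty_eq0P => k; rewrite ell_infty_mulE /=.
by have [->|_] := eqVneq k n; rewrite ?xn0 ?mul0r ?mulr0.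
Qed.

Theorem theorem3p2 (R : realType) (x : ell_infty R) :
  zero_divisor x <-> exists n : nat, x n = 0.
Proof.
split=> [xdiv|[n xn0]]; last first.
  by left; exists (unit_seq R n); [exact: unit_seq_neq0|exact: mul_unit_seq].
have [y /ell_infty_neq0[n yn0] xy0] : exists2 y : ell_infty R, y != 0 & x * y = 0.
  by case: xdiv => -[y yN0 xy0]; exists y => //; rewrite mulrC.
exists n; apply/eqP; have /ell_infty_eq0P/(_ n)/eqP := xy0.
by rewrite ell_infty_mulE mulf_eq0 (negPf yn0) orbF.
Qed.
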